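(* For any real numbers $0<\alpha<\beta\le 1/2$, there exists an irreducible Markov chain on a finite state space for which $$T(\alpha)=T(\beta)+\left(\frac1\alpha-1\right)\cdot T(1-\beta)=\frac{T(\beta)}{\alpha},$$ where the state space has at least two states.
   Context: For an irreducible discrete-time Markov chain $X=(X_t)_{t\ge 0}$ with finite state space $\Omega$ and stationary distribution $\pi$, the hitting time of $A\subseteq\Omega$ is $\tau_A=\min\{t\ge 0: X_t\in A\}$, and $\mathbb{E}_x$ denotes expectation for the chain started at $X_0=x$. For $\gamma\in(0,1)$, $$T(\gamma)=\max\{\mathbb{E}_x[\tau_A] : x\in\Omega,\ A\subseteq\Omega,\ \pi(A)\ge\gamma\}.$$ *)

(* Defs.v *)
From HB Require Import structures.
From mathcomp Require Import all_boot all_order all_algebra.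
From mathcomp Require Import all_classical all_reals all_analysis.

Set Implicit Arguments.
Unset Strict Implicit.
Unset Printing Implicit Defensive.

Import Order.TTheory GRing.Theory Num.Theory.
Local Open Scope ring_scope.

(* A time-homogeneous Markov chain on the finite state space [S] is given by
   its transition matrix [P]; [P x y] is the probability of moving from [x]
   to [y]. *)
Definition stochastic (R : realType) (S : finType) (P : S -> S -> R) : Prop :=
  (forall x y, 0 <= P x y) /\ (forall x, \sum_(y : S) P x y = 1).

(* For a chain started at [X_0 = x], the tuple [w] lists X_1, ..., X_t;
   [traj x w s] is X_s for s <= t (the default [x] of [nth] is never used). *)
Definition traj (S : finType) (x : S) (t : nat) (w : t.-tuple S) (s : nat) : S :=
  nth x (x :: w) s.

(* Probability that (X_1, ..., X_t) = w, for the chain started at x. *)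
Definition path_prob (R : realType) (S : finType) (P : S -> S -> R) (x : S)
    (t : nat) (w : t.-tuple S) : R :=
  \prod_(s < t) P (traj x w s) (traj x w s.+1).

(* Probability of an event [E] that depends only on X_0, ..., X_t. *)
Definition chain_prob (R : realType) (S : finType) (P : S -> S -> R) (x : S)
    (t : nat) (E : pred (t.-tuple S)) : R :=
  \sum_(w : t.-tuple S | E w) path_prob P x w.

Definition irreducible_chain (R : realType) (S : finType) (P : S -> S -> R) :
    Prop :=
  forall x y : S, exists t : nat,
    0 < chain_prob P x (fun w : t.-tuple S => traj x w t == y).

Definition stationary_distribution (R : realType) (S : finType)
    (P : S -> S -> R) (pi : S -> R) : Prop :=
  [/\ forall x, 0 <= pi x, \sum_(x : S) pi x = 1
    & forall y, \sum_(x : S) pi x * P x y = pi y].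

(* The event tau_A = t, where tau_A = min {t >= 0 : X_t \in A}. *)
Definition hits_first_at (S : finType) (A : {set S}) (x : S) (t : nat)
    (w : t.-tuple S) : bool :=
  (traj x w t \in A) && [forall s : 'I_t, traj x w s \notin A].

Definition hitting_time_law (R : realType) (S : finType) (P : S -> S -> R)
    (x : S) (A : {set S}) (t : nat) : R :=
  chain_prob P x (@hits_first_at S A x t).

(* E_x[tau_A], where tau_A takes values in {0, 1, 2, ...} U {+oo}.  The last
   term is the contribution of the event tau_A = +oo, which is 0 when this
   event has probability 0, since 0 * +oo = 0 in [\bar R]. *)
Definition expected_hitting_time (R : realType) (S : finType)
    (P : S -> S -> R) (x : S) (A : {set S}) : \bar R :=
  (\sum_(0 <= t <oo) (t%:R * hitting_time_law P x A t)%:E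
   + (1 - \sum_(0 <= t <oo) (hitting_time_law P x A t)%:E) * +oo)%E.

(* The base point -oo is never attained on a nonempty [S] when
   [gamma <= 1]: the set A = S is then admissible. *)
Definition max_hitting_time (R : realType) (S : finType) (P : S -> S -> R)
    (pi : S -> R) (gamma : R) : \bar R :=
  \big[maxe/-oo%E]_(x : S)
    \big[maxe/-oo%E]_(A : {set S} | gamma <= \sum_(y in A) pi y)
      expected_hitting_time P x A.

(* Main.v *)
Require Import Defs.
From HB Require Import structures.
From mathcomp Require Import all_boot all_order all_algebra.
From mathcomp Require Import all_classical all_reals all_analysis.
From mathcomp Require Import ring lra.

Set Implicit Arguments.
Unset Strict Implicit.
Unset Printing Implicit Defensive.

Import Order.TTheory GRing.Theory Num.Theory.
Local Open Scope ring_scope.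

(** The extremal chain is a star.  A hub of mass [1 - a - e] is joined to
    two leaves, of masses [a = alpha] and [e], where [0 < e < alpha] and
    [alpha + e < beta].  A leaf jumps to the hub with probability 1, and the hub
    jumps to each leaf with the probability that makes these masses stationary,
    and stays put otherwise.

    A set of mass at least [beta] has more mass than both leaves together, so
    it contains the hub, and every state outside it is a leaf, one step away
    from the hub.  The hub alone has mass at least [1 - beta], because
    [alpha + e < beta], and at least [beta], because [beta <= 1 / 2].  Hence
    [T beta = T (1 - beta) = 1].

    A set of mass at least [alpha] may avoid the hub.  If its mass is [p], the
    chain returns from the set to itself after [1 / p] steps on average, by
    Kac's formula; as the first of these steps leads to the hub, the hub takes
    [1 / p - 1] steps on average to hit the set, and the other leaf takes
    [1 / p].  The worst case is the heavy leaf as target with the light leaf as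
    start, whence [T alpha = 1 / alpha = T beta / alpha].  The light leaf
    provides the additional step from which the summand [T beta] comes: the hub
    alone would give only [(1 / alpha - 1) * T (1 - beta)].

    The expected hitting times come from [expected_hitting_timeE]: on a finite
    state space, a nonnegative solution of the first-step equations is the
    expected hitting time.  It is proved by comparing the solution with the
    truncated means of the hitting time, which satisfy the same recursion up to
    a multiple of the survival probability. *)

(** * First-step decomposition of trajectories *)

Lemma big_tuple_cons (R : nmodType) (S : finType) (t : nat)
    (E : pred (t.+1.-tuple S)) (F : t.+1.-tuple S -> R) :
  \sum_(w | E w) F w
  = \sum_(y : S) \sum_(w : t.-tuple S | E [tuple of y :: w])
      F [tuple of y :: w].
Proof.
rewrite pair_big_dep /=.
rewrite (reindex (fun p : S * t.-tuple S => [tuple of p.1 :: p.2])) //=.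
exists (fun w => (thead w, [tuple of behead w])) => [[y w] _|w _] /=.
  by congr pair; apply: val_inj.
by rewrite [RHS]tuple_eta; apply: val_inj.
Qed.

Lemma traj_cons (S : finType) (x y : S) (t : nat) (w : t.-tuple S) (s : nat) :
  (s <= t)%N -> traj x [tuple of y :: w] s.+1 = traj y w s.
Proof.
by move=> st; rewrite /traj /=; apply: set_nth_default; rewrite /= size_tuple.
Qed.

Lemma path_prob_cons (R : realType) (S : finType) (P : S -> S -> R) (x y : S)
    (t : nat) (w : t.-tuple S) :
  path_prob P x [tuple of y :: w] = P x y * path_prob P y w.
Proof.
rewrite /path_prob big_ord_recl /=; congr (_ * _).
by apply: eq_bigr => s _; rewrite /bump /= !traj_cons // ltnW.
Qed.

Lemma hits_first_at_cons (S : finType) (A : {set S}) (x y : S) (t : nat)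
    (w : t.-tuple S) :
  hits_first_at A x [tuple of y :: w]
  = (x \notin A) && hits_first_at A y w.
Proof.
rewrite /hits_first_at traj_cons // andbCA; congr (_ && _).
apply/forallP/andP => [H|[xA /forallP H] [[|s] st]] //.
  split; first exact: (H ord0).
  apply/forallP => s; have := H (lift ord0 s).
  by rewrite /= /bump /= traj_cons // ltnW.
by rewrite /= (traj_cons x y w (ltnW st)); exact: (H (Ordinal (st : (s < t)%N))).
Qed.

(** * Expected hitting times from the first-step equations *)

Section HittingTimes.
Variables (R : realType) (S : finType) (P : S -> S -> R).
Hypothesis Pst : stochastic P.
Variable A : {set S}.

Let P0 x y : 0 <= P x y. Proof. by case: Pst. Qed.
Let P1 x : \sum_y P x y = 1. Proof. by case: Pst. Qed.

Local Notation law := (hitting_time_law P).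

Lemma hitting_time_law0 x : law x A 0 = (x \in A)%:R.
Proof.
rewrite /hitting_time_law /chain_prob big_mkcond /=.
rewrite (eq_bigr (fun=> (x \in A)%:R)) => [|w _].
  by rewrite sumr_const card_tuple expn0.
rewrite /hits_first_at /path_prob big_ord0 /traj /=.
have -> : [forall s : 'I_0, nth x (x :: w) s \notin A] by apply/forallP; case.
by rewrite andbT; case: (_ \in _).
Qed.

Lemma hitting_time_lawS x t :
  law x A t.+1 = (x \notin A)%:R * \sum_y P x y * law y A t.
Proof.
rewrite /hitting_time_law /chain_prob big_tuple_cons mulr_sumr.
apply: eq_bigr => y _.
under eq_bigl do rewrite hits_first_at_cons.
case: (x \notin A) => /=; last by rewrite big_pred0_eq mul0r.
rewrite mul1r mulr_sumr; apply: eq_bigr => w _; exact: path_prob_cons.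
Qed.

Lemma hitting_time_law_ge0 x t : 0 <= law x A t.
Proof.
by apply: sumr_ge0 => w _; apply: prodr_ge0 => s _.
Qed.

(** The probability that the hitting time exceeds [t]. *)
Definition survival x t := 1 - \sum_(s < t.+1) law x A s.

(** The expectation of the hitting time restricted to the event that it is at
    most [t]. *)
Definition truncated_mean x t := \sum_(s < t.+1) s%:R * law x A s.

Lemma survival_in x t : x \in A -> survival x t = 0.
Proof.
move=> xA; rewrite /survival big_ord_recl hitting_time_law0 xA big1 ?addr0 ?subrr//.
by move=> s _; rewrite /bump /= hitting_time_lawS xA mul0r.
Qed.

Lemma truncated_mean_in x t : x \in A -> truncated_mean x t = 0.
Proof.
move=> xA; rewrite /truncated_mean big_ord_recl mul0r add0r big1 //.
by move=> s _; rewrite /bump /= hitting_time_lawS xA mul0r mulr0.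
Qed.

Lemma survival_0 x : survival x 0 = (x \notin A)%:R.
Proof.
rewrite /survival big_ord_recl big_ord0 hitting_time_law0.
by case: (x \in A) => /=; rewrite ?addr0 ?subrr ?subr0.
Qed.

Lemma survivalS x t : x \notin A -> survival x t.+1 = \sum_y P x y * survival y t.
Proof.
move=> xA; rewrite /survival big_ord_recl hitting_time_law0 (negbTE xA) add0r.
under [RHS]eq_bigr do rewrite mulrBr mulr1 mulr_sumr.
rewrite sumrB P1 exchange_big /=; congr (_ - _).
by apply: eq_bigr => s _; rewrite /bump /= hitting_time_lawS xA mul1r.
Qed.

Lemma survival_ge0 x t : 0 <= survival x t.
Proof.
elim: t x => [|t IH] x; first by rewrite survival_0.
have [xA|xA] := boolP (x \in A); first by rewrite survival_in.
by rewrite survivalS //; apply: sumr_ge0 => y _; apply: mulr_ge0.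
Qed.

Lemma truncated_meanS x t : x \notin A ->
  truncated_mean x t.+1 = \sum_y P x y * (truncated_mean y t + (1 - survival y t)).
Proof.
move=> xA; rewrite /truncated_mean big_ord_recl mul0r add0r.
under [RHS]eq_bigr => y _.
  rewrite /survival subKr -big_split /= mulr_sumr.
  over.
rewrite exchange_big /=; apply: eq_bigr => s _.
rewrite /bump /= hitting_time_lawS xA mul1r mulr_sumr.
by apply: eq_bigr => y _; rewrite -natr1; ring.
Qed.

(** The two sides are the expectations of the hitting time stopped at [t.+1]
    and [t], with an extra cost [c] when the set has not been hit by then.  For
    every [c] this quantity satisfies the recursion of the expected hitting
    time itself, so comparisons with [h] propagate from [t] to [t.+1]. *)
Lemma truncated_mean_first_step (c : R) x t : x \notin A ->
  truncated_mean x t.+1 + (t.+1%:R + c) * survival x t.+1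
  = 1 + \sum_y P x y * (truncated_mean y t + (t%:R + c) * survival y t).
Proof.
move=> xA; rewrite truncated_meanS // survivalS // mulr_sumr -big_split /=.
transitivity (\sum_y P x y
    + \sum_y P x y * (truncated_mean y t + (t%:R + c) * survival y t)); last first.
  by rewrite P1.
rewrite -[RHS]big_split /=; apply: eq_bigr => y _.
by rewrite -natr1; ring.
Qed.

(** [h] is a nonnegative solution of the first-step equations for the expected
    time to hit [A]. *)
Variable h : S -> R.
Hypothesis h_ge0 : forall x, 0 <= h x.
Hypothesis h_in : forall x, x \in A -> h x = 0.
Hypothesis h_out : forall x, x \notin A -> h x = 1 + \sum_y P x y * h y.

(** The comparison with cost [c = 0], which starts from [0 <= h]. *)
Lemma truncated_mean_lower x t :
  truncated_mean x t + t%:R * survival x t <= h x.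
Proof.
rewrite -[t%:R]addr0.
elim: t x => [|t IH] x.
  by rewrite /truncated_mean big_ord_recl big_ord0 !addr0 !mul0r addr0.
have [xA|xA] := boolP (x \in A).
  by rewrite truncated_mean_in // survival_in // mulr0 addr0.
rewrite truncated_mean_first_step // (h_out xA) lerD2l.
by apply: ler_sum => y _; apply: ler_wpM2l.
Qed.

(** The comparison with a cost [c] that bounds [h]; the sum of the values of [h]
    is such a bound. *)
Lemma truncated_mean_upper x t :
  h x <= truncated_mean x t + (t%:R + \sum_y h y) * survival x t.
Proof.
elim: t x => [|t IH] x; have [xA|xA] := boolP (x \in A).
- by rewrite truncated_mean_in // survival_in // mulr0 addr0 h_in.
- rewrite /truncated_mean big_ord_recl big_ord0 survival_0 xA mul0r !add0r mulr1.
  by rewrite (bigD1 x) //= lerDl sumr_ge0.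
- by rewrite truncated_mean_in // survival_in // mulr0 addr0 h_in.
rewrite truncated_mean_first_step // (h_out xA) lerD2l.
by apply: ler_sum => y _; apply: ler_wpM2l.
Qed.

Lemma truncated_mean_le x t : truncated_mean x t <= h x.
Proof.
by apply: le_trans (truncated_mean_lower x t); rewrite lerDl mulr_ge0 ?survival_ge0.
Qed.

(** Markov's inequality: [t] times the survival probability is at most [h x]. *)
Lemma survival_cvg0 x : (survival x @ \oo --> 0)%classic.
Proof.
apply/cvgrPdist_lt => e e0; near=> t.
have t0 : 0 < t%:R :> R.
  by rewrite ltr0n; near: t; exact: nbhs_infty_gt.
rewrite sub0r normrN ger0_norm ?survival_ge0 //.
have : h x < t%:R * e.
  by rewrite -ltr_pdivrMr //; near: t; exact: nbhs_infty_gtr.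
apply: contraTT; rewrite -!leNgt => et.
apply: le_trans (truncated_mean_lower x t).
apply: (@le_trans _ _ (t%:R * survival x t)); first by rewrite ler_wpM2l.
by rewrite lerDr; apply: sumr_ge0 => s _; rewrite mulr_ge0 ?hitting_time_law_ge0.
Unshelve. all: by end_near. Qed.

(** On the event that the hitting time lies in the interval from [t + 1] to
    [t + k], it is at least [t]. *)
Lemma survival_mean_le x t k :
  t%:R * (survival x t - survival x (t + k)) <= truncated_mean x (t + k) - truncated_mean x t.
Proof.
elim: k => [|k IH]; first by rewrite addn0 !subrr mulr0.
rewrite addnS.
have tS : survival x (t + k).+1 = survival x (t + k) - law x A (t + k).+1.
  by rewrite /survival [in LHS]big_ord_recr /= opprD addrA.
have mS : truncated_mean x (t + k).+1
    = truncated_mean x (t + k) + (t + k).+1%:R * law x A (t + k).+1.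
  by rewrite /truncated_mean [in LHS]big_ord_recr.
rewrite tS mS.
have : t%:R * law x A (t + k).+1 <= (t + k).+1%:R * law x A (t + k).+1.
  by rewrite ler_wpM2r ?hitting_time_law_ge0 // ler_nat -addnS leq_addr.
move: IH; lra.
Qed.

(** The two comparisons differ by [c] times the survival probability, which tends
    to 0, but they also contain the term [t] times the survival probability.
    The gap between the limit of the truncated means and the [t]-th one bounds
    this term. *)
Lemma truncated_mean_cvg x : (truncated_mean x @ \oo --> (h x : R^o))%classic.
Proof.
have mh t : truncated_mean x t <= h x := truncated_mean_le x t.
have ndm : nondecreasing_seq (truncated_mean x).
  apply/nondecreasing_seqP => t.
  rewrite /truncated_mean [leRHS]big_ord_recr /= lerDl mulr_ge0 //.
  exact: hitting_time_law_ge0.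
have cm : cvgn (truncated_mean x).
  apply: (@nondecreasing_is_cvgn R _ ndm).
  by exists (h x) => _ [t _ <-].
suff -> : h x = limn (truncated_mean x) :> R by [].
set L := limn _.
have mL t : truncated_mean x t <= L by exact: nondecreasing_cvgn_le.
apply/eqP; rewrite eq_le; apply/andP; split; last first.
  by apply: limr_le => //; near=> t.
(* Let [k] tend to infinity in [survival_mean_le]. *)
have tm t : t%:R * survival x t <= L - truncated_mean x t.
  rewrite -[survival x t]subr0.
  have ck : ((fun k => t%:R * (survival x t - survival x (t + k)%N)) @ \oo
      --> t%:R * (survival x t - 0))%classic.
    apply: cvgMr; apply: cvgB; first exact: cvg_cst.
    rewrite (_ : (fun k => survival x (t + k)%N) = (fun k => survival x (k + t)%N)).
      by have := survival_cvg0 x; rewrite -(cvg_shiftn t).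
    by apply/funext => k; rewrite addnC.
  rewrite -(cvg_lim _ ck) //; apply: limr_le; first exact: (cvgP _ ck).
  near=> k; apply: le_trans (survival_mean_le x t k) _.
  by rewrite lerD2r.
have cM : ((fun t => L + (\sum_y h y) * survival x t) @ \oo
    --> L + (\sum_y h y) * 0)%classic.
  by apply: cvgD; [exact: cvg_cst|apply: cvgMr; exact: survival_cvg0].
rewrite mulr0 addr0 in cM.
rewrite -(cvg_lim _ cM) //; apply: limr_ge; first exact: (cvgP _ cM).
near=> t; apply: le_trans (truncated_mean_upper x t) _.
by have := tm t; rewrite mulrDl; lra.
Unshelve. all: by end_near. Qed.

Lemma expected_hitting_timeE x : expected_hitting_time P x A = (h x)%:E.
Proof.
have E (f : nat -> R) (l : R) :
    ((fun t => \sum_(s < t.+1) f s) @ \oo --> (l : R^o))%classic ->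
    (\sum_(0 <= t <oo) (f t)%:E = l%:E)%E.
  move=> fl; apply: cvg_lim => //.
  rewrite (_ : (fun n => _) = EFin \o (fun n => \sum_(s < n) f s)); last first.
    by apply/funext => n /=; rewrite sumEFin big_mkord.
  apply: cvg_EFin; first by near=> n.
  by rewrite -(cvg_shiftS (fun n => \sum_(s < n) f s)).
have law1 : ((fun t => \sum_(s < t.+1) law x A s) @ \oo --> (1 : R^o))%classic.
  rewrite (_ : (fun t => _) = (fun t => 1 - survival x t)); last first.
    by apply/funext => t; rewrite /survival subKr.
  rewrite -[X in (_ --> X)%classic](subr0 1).
  by apply: cvgB; [exact: cvg_cst|exact: survival_cvg0].
rewrite /expected_hitting_time (E _ _ law1).
rewrite (E (fun t => t%:R * law x A t) _ (@truncated_mean_cvg x)).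
by rewrite subee // mul0e adde0.
Unshelve. all: by end_near. Qed.

End HittingTimes.


(** * The star chain *)

Lemma two_step_irreducible (R : realType) (S : finType) (P : S -> S -> R) (b : S) :
  (forall x y, 0 <= P x y) -> (forall x, 0 < P x b) -> (forall y, 0 < P b y) ->
  irreducible_chain P.
Proof.
move=> P0 Pb bP x y; exists 2.
apply: (@lt_le_trans _ _ (path_prob P x [tuple b; y])).
  by rewrite /path_prob !big_ord_recl big_ord0 /= mulr1 mulr_gt0.
rewrite /chain_prob (bigD1 [tuple b; y]) //= lerDl sumr_ge0 // => w _.
by apply: prodr_ge0.
Qed.

Lemma max_hitting_time_eq (R : realType) (S : finType) (P : S -> S -> R)
    (pi : S -> R) (gamma : R) (v : \bar R) (x0 : S) (A0 : {set S}) :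
  (forall x (A : {set S}), gamma <= \sum_(y in A) pi y ->
    (expected_hitting_time P x A <= v)%E) ->
  gamma <= \sum_(y in A0) pi y -> expected_hitting_time P x0 A0 = v ->
  max_hitting_time P pi gamma = v.
Proof.
move=> ub gA0 vE; apply/eqP; rewrite eq_le; apply/andP; split.
  apply: bigmax_le => [|x _]; first exact: leNye.
  apply: bigmax_le => [|A gA]; first exact: leNye.
  exact: ub.
apply: (Order.TotalTheory.bigmax_sup x0) => //.
by apply: (Order.TotalTheory.bigmax_sup A0); rewrite ?vE.
Qed.

Lemma big_option_bool (R : nmodType) (F : option bool -> R) :
  \sum_x F x = F None + F (Some true) + F (Some false).
Proof.
rewrite (bigD1 None) // (bigD1 (Some true)) // (bigD1 (Some false)) //=.
by rewrite big_pred0 ?addr0 ?addrA //; case=> [[]|].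
Qed.

Section StarChain.
Variables (R : realType) (a e : R).

(** [None] is the hub, [Some true] the heavy leaf of mass [a] and [Some false] the
    light leaf of mass [e]. *)
Definition star_kernel (x y : option bool) : R :=
  match x, y with
  | Some _, None => 1
  | Some _, Some _ => 0
  | None, None => 1 - (a + e) / (1 - a - e)
  | None, Some true => a / (1 - a - e)
  | None, Some false => e / (1 - a - e)
  end.

Definition star_mass (x : option bool) : R :=
  match x with
  | None => 1 - a - e
  | Some true => a
  | Some false => e
  end.

Hypotheses (e_gt0 : 0 < e) (e_lt_a : e < a) (ae_lt_half : a + e < 1 / 2).

Let hub_gt0 : 0 < 1 - a - e. Proof. by move: ae_lt_half; lra. Qed.
Let hub_neq0 : 1 - a - e != 0. Proof. exact: lt0r_neq0. Qed.
Let a_gt0 : 0 < a. Proof. exact: lt_trans e_lt_a. Qed.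

Lemma star_kernel_hub_gt0 y : 0 < star_kernel None y.
Proof.
case: y => [[]|] /=; rewrite ?divr_gt0 //.
by rewrite subr_gt0 ltr_pdivrMr // mul1r; move: ae_lt_half; lra.
Qed.

Lemma star_kernel_to_hub_gt0 x : 0 < star_kernel x None.
Proof. by case: x => [b|] //=; exact: (star_kernel_hub_gt0 None). Qed.

Lemma star_kernel_stochastic : stochastic star_kernel.
Proof.
split=> [[b|] y|[b|]].
- by case: y => //=.
- exact: ltW (star_kernel_hub_gt0 y).
- by rewrite big_option_bool /= !addr0.
- by rewrite big_option_bool /=; field.
Qed.

Lemma star_kernel_irreducible : irreducible_chain star_kernel.
Proof.
apply: (@two_step_irreducible _ _ _ None).
- by case: star_kernel_stochastic.
- exact: star_kernel_to_hub_gt0.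
- exact: star_kernel_hub_gt0.
Qed.

Lemma star_mass_stationary : stationary_distribution star_kernel star_mass.
Proof.
split.
- by case=> [[]|] /=; rewrite ltW.
- by rewrite big_option_bool /=; ring.
- by case=> [[]|]; rewrite big_option_bool /=; field.
Qed.

Lemma star_mass_set (A : {set option bool}) :
  \sum_(y in A) star_mass y
  = (None \in A)%:R * (1 - a - e) + (Some true \in A)%:R * a
    + (Some false \in A)%:R * e.
Proof.
rewrite big_mkcond big_option_bool /=.
by do 3!case: (_ \in A); rewrite ?mul0r ?mul1r.
Qed.

Lemma star_hitting_time_hub (A : {set option bool}) x : None \in A ->
  expected_hitting_time star_kernel x A = ((x \notin A)%:R)%:E.
Proof.
move=> hA.
apply: (expected_hitting_timeE star_kernel_stochastic
  (h := fun y => (y \notin A)%:R)) => // y.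
  by move=> ->.
case: y => [b|]; last by rewrite hA.
by move=> ->; rewrite big_option_bool hA /= !mul0r mulr0 !addr0.
Qed.

(** The values depend on the set only through its mass [p]: they are [1 / p - 1]
    from the hub and [1 / p] from a leaf outside the set. *)
Lemma star_hitting_time_leaf (A : {set option bool}) x :
  None \notin A -> 0 < \sum_(y in A) star_mass y ->
  expected_hitting_time star_kernel x A
  = (if x \in A then 0 else
     if x is None then (\sum_(y in A) star_mass y)^-1 - 1
     else (\sum_(y in A) star_mass y)^-1)%:E.
Proof.
move=> hA p_gt0.
apply: (expected_hitting_timeE star_kernel_stochastic (h := fun y : option bool =>
  if y \in A then 0 else
  if y is None then (\sum_(y in A) star_mass y)^-1 - 1
  else (\sum_(y in A) star_mass y)^-1)) => y.
- case: (y \in A) => //; case: y => [b|]; first by rewrite invr_ge0 ltW.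
  rewrite subr_ge0 invf_ge1 // star_mass_set (negbTE hA).
  by case: (_ \in A); case: (_ \in A); move: ae_lt_half a_gt0 e_gt0;
    rewrite /=; lra.
- by move=> ->.
move=> yA; rewrite (negbTE yA) big_option_bool (negbTE hA) /=.
case: y yA => [b|] _ /=; first by rewrite !mul0r !addr0; ring.
have := p_gt0; rewrite star_mass_set (negbTE hA).
have ae0 : a + e != 0 by rewrite lt0r_neq0 // addr_gt0.
have a0 : a != 0 by rewrite lt0r_neq0.
have e0 : e != 0 by rewrite lt0r_neq0.
case: (_ \in A); case: (_ \in A); rewrite /= ?(mul0r, mul1r, add0r, addr0);
  by [rewrite ltxx|move=> _; field; rewrite hub_neq0 ?ae0 ?a0 ?e0].
Qed.

(** A set of mass greater than [a + e] contains the hub, and then every start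
    outside it hits it in one step. *)
Lemma star_max_hitting_time_large gamma :
  a + e < gamma -> gamma <= 1 - a - e ->
  max_hitting_time star_kernel star_mass gamma = 1%E.
Proof.
move=> ae_lt gamma_le.
apply: (@max_hitting_time_eq _ _ _ _ _ _ (Some true) [set None]) => [x A gA||].
- have hA : None \in A.
    apply: contraLR ae_lt => hA; rewrite -leNgt (le_trans gA) // star_mass_set.
    rewrite (negbTE hA).
    by case: (_ \in A); case: (_ \in A); move: a_gt0 e_gt0; rewrite /=; lra.
  rewrite star_hitting_time_hub //; by case: (x \in A).
- by rewrite big_set1.
- by rewrite star_hitting_time_hub !inE.
Qed.

(** Every hitting time of a set of mass [p >= a] is at most [1 / a]: it is at most
    1 if the set contains the hub and at most [1 / p] otherwise.  The light leaf
    as start and the heavy leaf as target attain this bound. *)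
Lemma star_max_hitting_time_small :
  max_hitting_time star_kernel star_mass a = (a^-1)%:E.
Proof.
have a_le1 : a <= 1 by move: ae_lt_half e_gt0; lra.
have massa : \sum_(y in [set Some true]) star_mass y = a by rewrite big_set1.
apply: (@max_hitting_time_eq _ _ _ _ _ _ (Some false) [set Some true])
  => [x A aA||].
- have [hA|hA] := boolP (None \in A).
    rewrite star_hitting_time_hub // lee_fin (@le_trans _ _ 1) ?invf_ge1 //.
    by case: (x \in A).
  have p_gt0 := lt_le_trans a_gt0 aA.
  rewrite star_hitting_time_leaf // lee_fin.
  have pa : (\sum_(y in A) star_mass y)^-1 <= a^-1 by rewrite lef_pV2.
  have := invr_gt0 a; rewrite a_gt0; move: pa.
  by case: (x \in A); case: x => [b|]; lra.
- by rewrite massa.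
- by rewrite star_hitting_time_leaf ?massa // !inE.
Qed.

End StarChain.

Theorem mainTheorem5 (R : realType) (alpha beta : R)
    (alpha_gt0 : 0 < alpha) (alpha_lt_beta : alpha < beta)
    (beta_le_half : beta <= 1 / 2) :
  exists (S : finType) (P : S -> S -> R) (pi : S -> R),
    [/\ (2 <= #|S|)%N,
        stochastic P,
        irreducible_chain P,
        stationary_distribution P pi
      & let T := max_hitting_time P pi in
        T alpha = (T beta + (1 / alpha - 1)%:E * T (1 - beta)%R)%E /\
        (T beta + (1 / alpha - 1)%:E * T (1 - beta)%R)%E
          = (T beta * (1 / alpha)%:E)%E].
Proof.
have [e [e_gt0 e_lt_a ae_lt_b]] :
    exists e : R, [/\ 0 < e, e < alpha & alpha + e < beta].
  exists (Num.min alpha (beta - alpha) / 2).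
  have : 0 < Num.min alpha (beta - alpha) by rewrite lt_min alpha_gt0 subr_gt0.
  have : Num.min alpha (beta - alpha) <= alpha by rewrite ge_min lexx.
  have : Num.min alpha (beta - alpha) <= beta - alpha by rewrite ge_min lexx orbT.
  by set m := Num.min _ _ => *; split; lra.
have ae_lt_half : alpha + e < 1 / 2 by exact: lt_le_trans beta_le_half.
exists (option bool), (star_kernel alpha e), (star_mass alpha e); split.
- by rewrite card_option card_bool.
- exact: star_kernel_stochastic.
- exact: star_kernel_irreducible.
- exact: star_mass_stationary.
have Tb : max_hitting_time (star_kernel alpha e) (star_mass alpha e) beta = 1%E.
  by apply: star_max_hitting_time_large => //; lra.
have T1b :
    max_hitting_time (star_kernel alpha e) (star_mass alpha e) (1 - beta) = 1%E.
  by apply: star_max_hitting_time_large => //; lra.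
rewrite /= Tb T1b star_max_hitting_time_small // mule1 mul1e div1r -EFinD.
by rewrite [(1 + _)%R]addrC subrK.
Qed.
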